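(* Let $\alpha \in (0,1)$, let $\mathcal{W} = \mathbb{R}^d$, let $P$ and $Q$ be probability distributions over pairs $(x,s) \in \mathcal{X} \times \mathcal{S}$ with $\mathcal{S} \subseteq \mathbb{R}$, and let $\phi : \mathcal{X} \to \mathbb{R}^d$ be a fixed feature map. Let $$w^* \in \arg\min_{w \in \mathcal{W}} \ \mathbb{E}_{(x,s)\sim P}\left[\ell_\alpha(\langle \phi(x), w\rangle, s)\right],$$ where $\ell_\alpha$ is the pinball loss at level $\alpha$, and let $q_\alpha(x) = \langle \phi(x), w^* \rangle$ be the resulting linear quantile predictor. Assume that the density ratio between $Q_\phi$ and $P_\phi$ satisfies, for some $v \in \mathcal{W}$, $$\frac{dQ_\phi(\phi(x), s)}{dP_\phi(\phi(x), s)} = \langle \phi(x), v\rangle \quad \text{for all } (\phi(x), s) \in \operatorname{supp}(Q_\phi).$$ Then $q_\alpha$ is calibrated under $Q$ at quantile level $\alpha$, i.e. $$\mathbb{E}_{(x,s)\sim Q}\left[\mathbf{1}\{s < q_\alpha(x)\} - \alpha\right] = 0.$$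
   Context: For a quantile level $\alpha \in (0,1)$, the pinball loss of a prediction $\hat{s} \in \mathbb{R}$ for a true outcome $s \in \mathbb{R}$ is $$\ell_\alpha(\hat{s}, s) = (\alpha - \mathbf{1}\{s < \hat{s}\})(s - \hat{s}) = \begin{cases} \alpha (s - \hat{s}) & \text{if } s \ge \hat{s}, \\ (1-\alpha)(\hat{s} - s) & \text{if } s < \hat{s}. \end{cases}$$ Here $\mathcal{X}$ is the input space and $\mathcal{S}$ is the space of real-valued scores. $\mathcal{W}$ is the set of admissible weight vectors, taken to be all of $\mathbb{R}^d$. For any distribution $P$ over $\mathcal{X} \times \mathcal{S}$, $P_\phi$ denotes the induced (pushforward) distribution of $(\phi(x), s)$ on $\mathbb{R}^d \times \mathcal{S}$ when $(x,s) \sim P$; $Q_\phi$ is defined likewise from $Q$. The density ratio $dQ_\phi/dP_\phi$ is the Radon–Nikodym derivative of $Q_\phi$ with respect to $P_\phi$, and $\langle\cdot,\cdot\rangle$ is the Euclidean inner product on $\mathbb{R}^d$.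
   Formalization: Three hypotheses are added, as the claim can fail without each: the minimal expected pinball loss under P is finite; ⟨φ(x), v⟩ = 0 at P_φ-almost every point outside supp(Q_φ); and Q{s = q_α(x)} = 0 (no ties between score and predicted quantile). *)

(* Defs.v *)
From HB Require Import structures.
From mathcomp Require Import all_boot all_order all_algebra.
From mathcomp Require Import all_classical all_reals all_analysis.
Set Implicit Arguments.
Unset Strict Implicit.
Unset Printing Implicit Defensive.
Import Order.TTheory GRing.Theory Num.Theory.
Import numFieldNormedType.Exports.
Local Open Scope classical_set_scope.
Local Open Scope ring_scope.

(* The Borel sigma-algebra of R^d; the open sets are those of the library's
   topology on matrices (the entrywise max norm, equivalent to the Euclidean
   one). *)
HB.instance Definition _ (R : realType) (d : nat) :=
  @isMeasurable.Build (sigma_display (@open 'rV[R]_d)) 'rV[R]_d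
    <<s (@open 'rV[R]_d) >> (@sigma_algebra0 _ setT _)
    (@sigma_algebraC _ _) (@sigma_algebra_bigcup _ setT _).

Definition inner (R : realType) (d : nat) (u v : 'rV[R]_d) : R :=
  \sum_(i < d) u ord0 i * v ord0 i.

Definition pinball (R : realType) (alpha shat s : R) : R :=
  (alpha - (s < shat)%R%:R) * (s - shat).

Definition linear_predictor (R : realType) (d : nat) (X : Type)
    (phi : X -> 'rV[R]_d) (w : 'rV[R]_d) (x : X) : R :=
  inner (phi x) w.

Definition pinball_risk (R : realType) (d : nat) (dX : measure_display)
    (X : measurableType dX) (P : probability (X * R)%type R)
    (phi : X -> 'rV[R]_d) (alpha : R) (w : 'rV[R]_d) : \bar R :=
  'E_P[fun z => pinball alpha (linear_predictor phi w z.1) z.2]%E.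

Definition argmin (R : realType) (T : Type) (W : set T) (f : T -> \bar R)
    : set T :=
  [set w | W w /\ forall w', W w' -> (f w <= f w')%E].

Definition feature_score (R : realType) (d : nat) (X : Type)
    (phi : X -> 'rV[R]_d) (z : X * R) : 'rV[R]_d * R :=
  (phi z.1, z.2).

Lemma measurable_feature_score (R : realType) (d : nat) (dX : measure_display)
    (X : measurableType dX) (phi : {mfun X >-> 'rV[R]_d}) :
  measurable_fun setT (feature_score phi).
Proof.
apply/measurable_fun_pairP; split.
  exact: (measurableT_comp (measurable_funPT phi) measurable_fst).
exact: measurable_snd.
Qed.

HB.instance Definition _ (R : realType) (d : nat) (dX : measure_display)
    (X : measurableType dX) (phi : {mfun X >-> 'rV[R]_d}) :=
  isMeasurableFun.Build _ _ _ _ (feature_score phi)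
    (measurable_feature_score phi).

(* P_phi, the law of (phi x, s) under P *)
Definition feature_distribution (R : realType) (d : nat)
    (dX : measure_display) (X : measurableType dX)
    (P : probability (X * R)%type R) (phi : {mfun X >-> 'rV[R]_d})
    : probability ('rV[R]_d * R)%type R :=
  distribution P (feature_score phi).

Definition measure_support (R : realType) (T : topologicalType)
    (mu : set T -> \bar R) : set T :=
  [set z | forall U : set T, open U -> U z -> (0 < mu U)%E].

(* Any two versions agree mu-almost everywhere; the library's 'd nu '/d mu is
   only meaningful when nu `<< mu. *)
Definition density_ratio (R : realType) (dT : measure_display)
    (T : measurableType dT) (nu mu : probability T R) : T -> \bar R :=
  Radon_Nikodym (charge_of_finite_measure nu) mu.

Definition calibrated (R : realType) (dX : measure_display)
    (X : measurableType dX) (Q : probability (X * R)%type R)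
    (alpha : R) (q : X -> R) : Prop :=
  ('E_Q[fun z => ((z.2 < q z.1)%R%:R - alpha)%R] = 0)%E.

(* Main.v *)
(* Moving from w* along the direction c v changes the pinball risk under P, to
   first order, by E_P[(1{s < q} - alpha) c <phi, v>]; minimality makes this
   nonnegative for c = 1 and c = -1, so E_P[(1{s < q} - alpha) <phi, v>] = 0.
   Since <phi, v> is the density of Q_phi with respect to P_phi, the left-hand
   side is E_Q[1{s < q} - alpha].  The pinball loss is not differentiable at
   ties s = q, but Q_phi gives ties no mass, so the direction <phi, v> vanishes
   there P_phi-almost everywhere. *)
Require Import Defs.
From HB Require Import structures.
From mathcomp Require Import all_boot all_order all_algebra.
From mathcomp Require Import all_classical all_reals all_analysis.
From mathcomp Require Import measurable_realfun lra.
Import Order.TTheory GRing.Theory Num.Theory.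
Import numFieldNormedType.Exports.
Local Open Scope classical_set_scope.
Local Open Scope ring_scope.

Set Implicit Arguments.
Unset Strict Implicit.
Unset Printing Implicit Defensive.

(** * Borel structure of the product of R^d with the real line *)

Lemma measurable_coord (R : realType) (d : nat) (i : 'I_d) :
  measurable_fun setT (fun u : 'rV[R]_d => u ord0 i).
Proof.
apply: (measurability _ (RGenOpens.measurableE R)).
move=> _ [_ [a [b ->] <-]]; rewrite setTI; apply: sub_sigma_algebra.
have /continuousP := @coord_continuous R 1 d ord0 i.
by apply; exact: interval_open.
Qed.

Lemma measurable_inner (R : realType) (d : nat) (v : 'rV[R]_d) :
  measurable_fun setT (fun u : 'rV[R]_d => inner u v).
Proof.
apply: measurable_sum => i; apply: measurable_funM => //.
exact: measurable_coord.
Qed.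

(** The index type is countable, so [pickle] enumerates the boxes; testing membership entry by entry
    reduces measurability to that of the coordinates. *)
Definition rational_box (R : realType) (d : nat) (c : 'rV[rat]_d * rat * nat)
    : set ('rV[R]_d * R) :=
  [set z : 'rV[R]_d * R |
    (forall i, ball (ratr (c.1.1 ord0 i) : R) c.2.+1%:R^-1 (z.1 ord0 i))
    /\ ball (ratr c.1.2 : R) c.2.+1%:R^-1 z.2].

Lemma measurable_rational_box (R : realType) (d : nat)
  (c : 'rV[rat]_d * rat * nat) : measurable (@rational_box R d c).
Proof.
rewrite [X in measurable X](_ : _ =
    (\bigcap_(i in [set: 'I_d])
      ((fun z : 'rV[R]_d * R => z.1 ord0 i) @^-1`
         ball (ratr (c.1.1 ord0 i) : R) c.2.+1%:R^-1)) `&`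
    (snd @^-1` ball (ratr c.1.2 : R) c.2.+1%:R^-1)); last first.
  apply/seteqP; split=> z /=; first by move=> [h1 h2]; split=> [i _|];
    [exact: h1|exact: h2].
  by move=> [h1 h2]; split=> [i|]; [exact: h1|exact: h2].
apply: measurableI.
  apply: fin_bigcap_measurable => // i _; rewrite -[X in measurable X]setTI.
  apply: (measurableT_comp (@measurable_coord R d i) measurable_fst) => //.
  exact: measurable_ball.
by rewrite -[X in measurable X]setTI; apply: measurable_snd => //;
  exact: measurable_ball.
Qed.

(** With 1/(k+1) < e/2 and rational centres within 1/(k+1) of the entries of [z], the triangle
    inequality puts the box inside the ball of radius [e] around [z]. *)
Lemma rational_box_basis (R : realType) (d : nat) (U : set ('rV[R]_d * R)) z :
  open U -> U z -> exists2 c, rational_box c z & rational_box c `<=` U.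
Proof.
move=> oU Uz; have /nbhs_ballP[e /= e0 eU] : nbhs z U by exact: open_nbhs_nbhs.
have e20 : 0 < e / 2 by rewrite divr_gt0.
have [k _ /(_ k (leqnn k)) ke] := near_infty_natSinv_lt (PosNum e20).
set r := k.+1%:R^-1 in ke; have r0 : 0 < r by rewrite invr_gt0.
have rat_near (x : R) : exists q : rat, ball (ratr q : R) r x.
  have [y [xy [q _ qy]]] := @dense_rat R (ball x r)
    (ex_intro _ x (ballxx x r0)) (ball_open x r).
  by exists q; rewrite qy; exact: ball_sym.
pose q := \row_i sval (cid (rat_near (z.1 ord0 i))).
exists (q, sval (cid (rat_near z.2)), k).
  by split=> [i|] /=; [rewrite mxE; case: cid|case: cid].
move=> y [/= y1 y2]; apply: eU.
have close (c a b : R) : ball c r a -> ball c r b -> ball a e b.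
  move=> ca cb; apply: (@le_ball _ _ _ (r + r)).
    by rewrite [leRHS]splitr lerD// ltW.
  by apply: ball_triangle cb; exact: ball_sym.
split => /=; last by apply: close y2; case: cid.
split=> // i j; rewrite (ord1 i); apply: close (y1 j).
by rewrite mxE; case: cid.
Qed.

(** The sigma-algebra here is the product one, not the one generated by the open sets of the
    product; [U] is recovered as the countable union of the rational boxes it contains. *)
Lemma open_prod_measurable (R : realType) (d : nat) (U : set ('rV[R]_d * R)) :
  open U -> measurable U.
Proof.
move=> oU.
rewrite (_ : U = \bigcup_n
    (if unpickle n is Some c then
       if `[< rational_box c `<=` U >] then rational_box c else set0
     else set0)); last first.
  apply/seteqP; split=> z.
    move=> /(rational_box_basis oU)[c cz cU]; exists (pickle c) => //.
    by rewrite pickleK asboolT.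
  move=> [n _]; case: unpickle => // c; case: ifPn => // /asboolP cU.
  exact: cU.
apply: bigcupT_measurable => n; case: unpickle => // c; case: ifPn => // _.
exact: measurable_rational_box.
Qed.

(* This needs second countability: an arbitrary union of null open sets need
   not be null. *)
Lemma measure_support_negligible (R : realType) (d : nat)
    (mu : {measure set ('rV[R]_d * R) -> \bar R}) :
  mu.-negligible (~` measure_support mu).
Proof.
pose F n := if unpickle n is Some c then
    if mu (rational_box c) == 0%E then rational_box c else set0
  else set0 : set ('rV[R]_d * R).
apply: (@negligibleS _ _ _ _ (\bigcup_n F n)); last first.
  apply: negligible_bigcup => n; rewrite /F; case: unpickle => [c|].
    case: ifPn => [/eqP c0|_]; last exact: negligible_set0.
    by apply/negligibleP => //; exact: measurable_rational_box.
  exact: negligible_set0.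
(* A point off the support has a null open neighbourhood, hence lies in a null rational box. *)
move=> z /existsNP[U /not_implyP[oU /not_implyP[Uz U0]]].
have [c cz cU] := rational_box_basis oU Uz; exists (pickle c) => //.
rewrite /F pickleK ifT// eq_le measure_ge0 andbT.
apply: (@le_trans _ _ (mu U)); last by rewrite leNgt; exact/negP.
apply: le_measure => //; rewrite inE; first exact: measurable_rational_box.
exact: open_prod_measurable.
Qed.

(** On a measurable [nu]-null set [A] containing [N], the ratio integrates to [nu E] = 0 over every
    measurable subset [E], so it vanishes [mu]-almost everywhere on [A]. *)
Lemma density_ratio_negligible (R : realType) (dT : measure_display)
    (T : measurableType dT) (nu mu : probability T R) (N : set T) :
  nu `<< mu -> nu.-negligible N ->
  {ae mu, forall x, N x -> density_ratio nu mu x = 0%E}.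
Proof.
move=> numu [A [mA A0 NA]].
suff : ae_eq mu A (density_ratio nu mu) (cst 0%E).
  by apply: filterS => x Ax Nx; apply: Ax; exact: NA.
have numu' : charge_of_finite_measure nu `<< mu by [].
apply: integral_ae_eq => //.
  exact: integrableS (Radon_Nikodym_integrable numu').
move=> E EA mE; rewrite integral0 /density_ratio -Radon_Nikodym_integral//.
by apply: (subset_measure0 mE mA EA).
Qed.

(** * First-order behaviour of the pinball loss *)

Lemma pinball_ge0 (R : realType) (alpha x s : R) :
  0 < alpha < 1 -> 0 <= pinball alpha x s.
Proof.
rewrite /pinball => /andP[a0 a1].
have [sx|xs] /= := ltP s x; last by rewrite subr0 mulr_ge0 ?subr_ge0// ltW.
by rewrite -mulrNN mulr_ge0// opprB subr_ge0 ltW.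
Qed.

(** Convexity in the prediction, with the slope taken at the endpoint [y]: the increment from [x] to
    [y] is thereby bounded from above. *)
Lemma pinball_subgradient (R : realType) (alpha x y s : R) :
  pinball alpha y s <= pinball alpha x s + ((s < y)%R%:R - alpha) * (y - x).
Proof.
rewrite /pinball.
by have [sx|xs] := ltP s x; have [sy|ys] := ltP s y => /=; nra.
Qed.

Lemma norm_pinball_slope (R : realType) (alpha : R) (b : bool) :
  0 < alpha < 1 -> `|b%:R - alpha| <= 1.
Proof. by move=> /andP[a0 a1]; rewrite ler_norml; case: b => /=; lra. Qed.

Section pinball_measurable.
Context (R : realType) (dT : measure_display) (T : measurableType dT).
Implicit Types (alpha : R) (s q : T -> R).

Lemma measurable_pinball_slope alpha s q :
  measurable_fun setT s -> measurable_fun setT q ->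
  measurable_fun setT (fun z => (s z < q z)%R%:R - alpha).
Proof.
move=> ms mq; apply: measurable_funB => //.
have mb : measurable_fun [set: bool] (fun b : bool => b%:R : R) by [].
exact: (measurableT_comp mb (measurable_fun_ltr ms mq)).
Qed.

Lemma measurable_pinball alpha s q :
  measurable_fun setT s -> measurable_fun setT q ->
  measurable_fun setT (fun z => pinball alpha (q z) (s z)).
Proof.
move=> ms mq; apply: measurable_funM; last exact: measurable_funB.
rewrite [X in measurable_fun _ X](_ : _ =
  fun z => - ((s z < q z)%R%:R - alpha)); last first.
  by apply/funext => z; rewrite opprB.
exact/measurableT_comp/measurable_pinball_slope.
Qed.

End pinball_measurable.

(** For steps [t n] decreasing to 0, minimality and the subgradient inequality at the displaced
    prediction make the integral of [u n] nonnegative. Dominated convergence, with bound |g|, passes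
    to the slope at [q] itself. *)
Lemma pinball_directional_derivative_ge0 (R : realType) (dT : measure_display)
    (T : measurableType dT) (mu : {measure set T -> \bar R})
    (alpha : R) (alpha01 : 0 < alpha < 1) (s q g : T -> R)
    (ms : measurable_fun setT s) (mq : measurable_fun setT q)
    (q_fin : (\int[mu]_z (pinball alpha (q z) (s z))%:E < +oo)%E)
    (g_int : mu.-integrable setT (EFin \o g))
    (q_min : forall t : R, (\int[mu]_z (pinball alpha (q z) (s z))%:E <=
       \int[mu]_z (pinball alpha (q z + t * g z) (s z))%:E)%E)
    (tie : {ae mu, forall z, s z = q z -> g z = 0}) :
  (0 <= \int[mu]_z (((s z < q z)%R%:R - alpha) * g z)%:E)%E.
Proof.
have mg : measurable_fun setT g by exact/measurable_EFinP/(measurable_int mu).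
pose t n : R := n.+1%:R^-1.
pose u n z : R := ((s z < q z + t n * g z)%R%:R - alpha) * g z.
have mqt n : measurable_fun setT (fun z => q z + t n * g z).
  by apply: measurable_funD => //; exact: measurable_funM.
have u_meas n : measurable_fun setT (u n).
  by apply: measurable_funM => //; exact: measurable_pinball_slope.
have u_le n z : `|u n z| <= `|g z|.
  by rewrite normrM ler_piMl// norm_pinball_slope.
have u_int n : mu.-integrable setT (EFin \o u n).
  apply: le_integrable g_int => //; first exact/measurable_EFinP.
  by move=> z _ /=; rewrite lee_fin.
have L_int : mu.-integrable setT (fun z => (pinball alpha (q z) (s z))%:E).
  apply/integrableP; split; first exact/measurable_EFinP/measurable_pinball.
  under eq_integral do rewrite gee0_abs ?lee_fin ?pinball_ge0//.
  exact: q_fin.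
have u_ge0 n : (0 <= \int[mu]_z (u n z)%:E)%E.
  have t0 : 0 < t n by rewrite invr_gt0.
  have tu_int : mu.-integrable setT (fun z => (t n)%:E * (u n z)%:E)%E.
    exact: integrableZl (u_int n).
  have : (\int[mu]_z (pinball alpha (q z) (s z))%:E <=
      \int[mu]_z ((pinball alpha (q z) (s z))%:E + (t n)%:E * (u n z)%:E))%E.
    apply: (le_trans (q_min (t n))); apply: ge0_le_integral => //.
    - by move=> z _; rewrite lee_fin pinball_ge0.
    - exact/measurable_EFinP/measurable_pinball.
    - by apply: emeasurable_funD; [exact: measurable_int L_int|
        exact: measurable_int tu_int].
    - move=> z _; rewrite -EFinM -EFinD lee_fin.
      apply: (le_trans (pinball_subgradient _ (q z) _ _)).
      by rewrite lerD2l addrAC subrr add0r mulrCA.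
  rewrite integralD// integralZl//; last exact: u_int.
  (* The risk at [q] is finite by [q_fin], so it cancels from both sides; the positive factor [t n]
     is then removed. *)
  have := leeD2lE 0%E _ (integrable_fin_num measurableT L_int).
  by rewrite adde0 => ->; rewrite pmule_rge0// lte_fin.
(* For z off the ties, u n z is eventually constant. *)
have u_cvg : {ae mu, forall z, [set: T] z ->
    (u n z)%:E @[n --> \oo] --> (((s z < q z)%R%:R - alpha) * g z)%:E}.
  move: tie; apply: filterS => z tie _.
  apply: cvg_near_cst.
  have [g0|g0] := eqVneq (g z) 0; first by near=> n; rewrite /u g0 !mulr0.
  have sq : 0 < `|s z - q z|.
    by rewrite normr_gt0 subr_eq0; apply: contra_neq g0 => /tie.
  (* For [t n] below this quotient, the shift [t n * g z] is smaller than the gap between [s z] and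
     [q z], so the prediction stays on the same side of [s z]. *)
  have e0 : 0 < `|s z - q z| / `|g z| by rewrite divr_gt0// normr_gt0.
  have := near_infty_natSinv_lt (PosNum e0); apply: filterS => n /=.
  rewrite ltr_pdivlMr ?normr_gt0// => tg; congr (((_ : bool)%:R - _) * _)%:E.
  have {}tg : `|t n * g z| < `|s z - q z|.
    by rewrite normrM ger0_norm// invr_ge0.
  move: tg; rewrite ltr_norml => /andP[].
  have [sz|sz] := ltP (s z) (q z).
    by rewrite ltr0_norm ?subr_lt0// => h1 h2; lra.
  rewrite ger0_norm ?subr_ge0// => h1 h2; apply/negbTE; rewrite -leNgt; lra.
have gabs : mu.-integrable setT (fun z => `|(g z)%:E|%E).
  exact: integrable_abse.
have Eu_meas n : measurable_fun setT (EFin \o u n) by exact/measurable_EFinP.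
have Elim_meas : measurable_fun setT
    (fun z => (((s z < q z)%R%:R - alpha) * g z)%:E).
  apply/measurable_EFinP/measurable_funM => //.
  exact: measurable_pinball_slope.
have dom : {ae mu, forall z n, [set: T] z ->
    (`|(EFin \o u n) z| <= `|(g z)%:E|)%E}.
  by apply: aeW => z n _ /=; rewrite lee_fin.
have [_ _] :=
  dominated_convergence measurableT Eu_meas Elim_meas u_cvg gabs dom.
by move=> /cvge_to_ge; apply; apply: nearW => n; exact: u_ge0.
Unshelve. all: by end_near. Qed.

(** * Transfer between the feature laws, and calibration *)

Lemma ae_distribution (R : realType) (d1 d2 : measure_display)
    (T1 : measurableType d1) (T2 : measurableType d2) (P : probability T1 R)
    (F : {mfun T1 >-> T2}) (A : T2 -> Prop) :
  {ae distribution P F, forall y, A y} -> {ae P, forall x, A (F x)}.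
Proof.
move=> [N [mN N0 AN]]; exists (F @^-1` N); split => //.
  by rewrite -[X in measurable X]setTI; exact: measurable_funPT.
by move=> x /= nA; exact: AN.
Qed.

Lemma innerDZ (R : realType) (d : nat) (u w v : 'rV[R]_d) (t : R) :
  inner u (w + t *: v) = inner u w + t * inner u v.
Proof.
rewrite /inner mulr_sumr -big_split /=; apply: eq_bigr => i _.
by rewrite !mxE mulrDr mulrCA.
Qed.

Theorem theorem5p3 (R : realType) (d : nat)
  (dX : measure_display) (X : measurableType dX)
  (scores : set R) (mscores : measurable scores)
  (alpha : R) (alpha01 : 0 < alpha < 1)
  (P Q : probability (X * R)%type R)
  (Pscores : P ([set: X] `*` scores) = 1%E)
  (Qscores : Q ([set: X] `*` scores) = 1%E)
  (phi : {mfun X >-> 'rV[R]_d})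
  (wstar : 'rV[R]_d)
  (wstar_min : argmin [set: 'rV[R]_d] (pinball_risk P phi alpha) wstar)
  (* the minimal expected loss is finite *)
  (risk_fin : (pinball_risk P phi alpha wstar < +oo)%E)
  (v : 'rV[R]_d)
  (* the density ratio of Q_phi and P_phi exists and is linear on supp Q_phi *)
  (QP : feature_distribution Q phi `<< feature_distribution P phi)
  (ratio : {ae feature_distribution P phi, forall z : 'rV[R]_d * R,
     measure_support (feature_distribution Q phi) z ->
     density_ratio (feature_distribution Q phi) (feature_distribution P phi) z
       = (inner z.1 v)%:E})
  (* regularity: the linear formula also gives the (zero) density off
     supp Q_phi, and the score does not tie with its predicted quantile *)
  (ratio_off : {ae feature_distribution P phi, forall z : 'rV[R]_d * R,
     ~ measure_support (feature_distribution Q phi) z -> inner z.1 v = 0})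
  (no_tie : Q [set z | z.2 = linear_predictor phi wstar z.1] = 0%E) :
  calibrated Q alpha (linear_predictor phi wstar).
Proof.
set F : {mfun (X * R)%type >-> ('rV[R]_d * R)%type} := feature_score phi.
set Pf := feature_distribution P phi in QP ratio ratio_off *.
set Qf := feature_distribution Q phi in QP ratio ratio_off *.
set f := density_ratio Qf Pf in ratio *.
pose q (z : 'rV[R]_d * R) := inner z.1 wstar.
pose g (z : 'rV[R]_d * R) := inner z.1 v.
have mq : measurable_fun setT q.
  exact: (measurableT_comp (measurable_inner wstar) measurable_fst).
have mg : measurable_fun setT g.
  exact: (measurableT_comp (measurable_inner v) measurable_fst).
have ms : measurable_fun setT (snd : 'rV[R]_d * R -> R).
  exact: measurable_snd.
(* [h] is both the slope of the pinball loss at the prediction and the calibration error. *)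
pose h (z : 'rV[R]_d * R) : R := (z.2 < q z)%R%:R - alpha.
have mh : measurable_fun setT h by exact: measurable_pinball_slope.
have QP' : charge_of_finite_measure Qf `<< Pf by [].
have fi : Pf.-integrable setT f := Radon_Nikodym_integrable QP'.
have mf := measurable_int _ fi.
have f0 := density_ratio_negligible QP (measure_support_negligible Qf).
(* Off the support of [Qf], a [Qf]-null set, the density vanishes almost everywhere, and [ratio_off]
   makes [g] vanish there too. *)
have fg : ae_eq Pf setT f (EFin \o g).
  move: ratio ratio_off f0; apply: filterS3 => z zin zout z0 _ /=.
  have [Sz|Sz] := pselect (measure_support Qf z); first exact: zin.
  by rewrite [f z]z0// /g zout.
have tie : {ae Pf, forall z, z.2 = q z -> g z = 0}.
  have Qtie : Qf.-negligible [set z | z.2 = q z].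
    apply/negligibleP => //.
    rewrite (_ : [set z | _] = (fun z => z.2 - q z) @^-1` [set 0]); last first.
      by apply/seteqP; split => z /=; [move=> ->; rewrite subrr|
        move=> /eqP; rewrite subr_eq0 => /eqP].
    rewrite -[X in measurable X]setTI.
    by apply: measurable_funB => //; exact: measurable_set1.
  move: fg (density_ratio_negligible QP Qtie); apply: filterS2 => z fgz f0z zq.
  by have := fgz I; rewrite [f z]f0z// => -[].
(* Integrability of [g] is inherited from the density, with which it agrees [Pf]-almost
   everywhere. *)
have gi : P.-integrable setT (EFin \o (g \o F)).
  apply/integrableP; split; first exact/measurable_EFinP/measurableT_comp.
  have mg' : measurable_fun setT (fun z => `|(EFin \o g) z|)%E.
    by apply: measurableT_comp => //; exact/measurable_EFinP.
  have <- : (\int[Pf]_z `|(EFin \o g) z| = \int[P]_z `|(EFin \o (g \o F)) z|)%E.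
    by rewrite ge0_integral_distribution.
  have /integrableP[_] := fi.
  rewrite (ae_eq_integral (abse \o (EFin \o g)))//.
    exact: measurableT_comp.
  exact: ae_eq_abse.
have risk w : pinball_risk P phi alpha w =
    (\int[P]_z (pinball alpha (inner (F z).1 w) (F z).2)%:E)%E.
  by rewrite /pinball_risk unlock.
have qlin t z : q (F z) + t * g (F z) = inner (F z).1 (wstar + t *: v).
  by rewrite innerDZ.
have tieP := ae_distribution tie.
have wmin t : (\int[P]_z (pinball alpha (q (F z)) (F z).2)%:E <=
    \int[P]_z (pinball alpha (q (F z) + t * g (F z)) (F z).2)%:E)%E.
  rewrite [leRHS](_ : _ = pinball_risk P phi alpha (wstar + t *: v)).
    by rewrite -risk; exact: wstar_min.2.
  by rewrite risk; apply: eq_integral => z _; rewrite qlin.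
have E_ge0 (c : R) :
    (0 <= \int[P]_z ((((F z).2 < q (F z))%R%:R - alpha) * (c * g (F z)))%:E)%E.
  apply: (@pinball_directional_derivative_ge0 _ _ _ _ _ _ (snd \o F) (q \o F)
     (fun z => c * g (F z))) => //.
  - exact: measurableT_comp.
  - exact: measurableT_comp.
  - by rewrite -risk.
  - exact: integrableZl gi.
  (* A step [t] in the direction [c * g] is the step [t * c] along [v]. *)
  - move=> t; apply: (le_trans (wmin (t * c))).
    by under [leRHS]eq_integral do rewrite mulrA.
  - by apply: filterS tieP => z zq /zq ->; rewrite mulr0.
have hgi : P.-integrable setT (fun z => (h (F z) * g (F z))%:E).
  apply: le_integrable gi => //.
    apply/measurable_EFinP/measurable_funM; exact: measurableT_comp.
  move=> z _ /=; rewrite lee_fin normrM ler_piMl//.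
  exact: norm_pinball_slope.
have E0 : (\int[P]_z (h (F z) * g (F z))%:E = 0)%E.
  apply/eqP; rewrite eq_le; apply/andP; split; last first.
    by have := E_ge0 1; under eq_integral do rewrite mul1r.
  have := E_ge0 (-1); under eq_integral do rewrite mulN1r mulrN EFinN.
  by rewrite integralN ?oppe_ge0// integrable_add_def.
have hi : Q.-integrable setT (EFin \o (h \o F)).
  have := finite_measure_integrable_cst Q 1 measurableT.
  apply: le_integrable => //.
    exact/measurable_EFinP/measurableT_comp.
  by move=> z _ /=; rewrite lee_fin normr1 norm_pinball_slope.
have hQi : Qf.-integrable setT (EFin \o h).
  by apply: integrable_pushforward => //; exact/measurable_EFinP.
rewrite /calibrated unlock.
transitivity (\int[Qf]_z (h z)%:E)%E.
  by rewrite integral_distribution//; exact/measurable_EFinP.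
(* The integral of [h] under [Qf] becomes that of [h * f] under [Pf]; replacing [f] by [g] and
   pulling back to [P] leaves [E0]. *)
rewrite -(Radon_Nikodym_change_of_variables QP measurableT hQi).
transitivity (\int[Pf]_z (h z * g z)%:E)%E.
  apply: ae_eq_integral => //.
  - by apply: emeasurable_funM => //; exact/measurable_EFinP.
  - exact/measurable_EFinP/measurable_funM.
  - move: fg; apply: filterS => z fgz _.
    by rewrite EFinM -[RHS]/(_ * (EFin \o g) z)%E -fgz.
by rewrite integral_distribution//; exact/measurable_EFinP/measurable_funM.
Qed.
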